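(* Let $\mathcal M$ and $\mathcal N=\{N^{(\lambda)}:\lambda\in\mathbb R_{>0}\}$ be two quasianalytic weight matrices such that $\sup_{k\in\mathbb N_{>0}}(n^{(\lambda)}_k)^{1/k}=+\infty$ for all $\lambda>0$ (Roumieu case) resp. $\lim_{k\to+\infty}(n^{(\lambda)}_k)^{1/k}=+\infty$ for all $\lambda>0$ (Beurling case). Then $j^\infty(\mathcal E^{0,r}_{\{\mathcal M\}})\cap\Lambda^r_{[\mathcal N]}\subsetneq\Lambda^r_{[\mathcal N]}$ (and hence also $j^\infty(\mathcal E^{0,r}_{(\mathcal M)})\cap\Lambda^r_{[\mathcal N]}\subsetneq\Lambda^r_{[\mathcal N]}$). In particular the Borel map $j^\infty:\mathcal E^{0,r}_{[\mathcal N]}\to\Lambda^r_{[\mathcal N]}$ is not surjective.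
   Context: For a sequence $M=(M_p)_{p\in\mathbb N}$ of positive reals write $m_p:=M_p/p!$. $M$ is a weight sequence if $1=M_0\le M_1$, $M_p^2\le M_{p-1}M_{p+1}$ for all $p\ge1$, and $\liminf_{p\to\infty}m_p^{1/p}>0$; it is quasianalytic if $\sum_{p\ge1}M_{p-1}/M_p=+\infty$. A weight matrix is a family $\mathcal M=\{M^{(\lambda)}:\lambda\in\mathbb R_{>0}\}$ of weight sequences with $M^{(\lambda)}_p\le M^{(\kappa)}_p$ for all $p$ whenever $\lambda\le\kappa$; write $n^{(\lambda)}_p:=N^{(\lambda)}_p/p!$. It is quasianalytic if every member is quasianalytic. For $U\subseteq\mathbb R^r$ open, $K\subseteq U$ compact, $h>0$: $\|f\|^M_{K,h}:=\sup_{\alpha\in\mathbb N^r,x\in K}|\partial^\alpha f(x)|/(h^{|\alpha|}M_{|\alpha|})$. $\mathcal E_{\{\mathcal M\}}(U)$: smooth $f$ such that for every compact $K\subseteq U$ there exist $\lambda>0$, $h>0$ with $\|f\|^{M^{(\lambda)}}_{K,h}<\infty$; $\mathcal E_{(\mathcal M)}(U)$: smooth $f$ with $\|f\|^{M^{(\lambda)}}_{K,h}<\infty$ for all compact $K$, all $\lambda>0$, all $h>0$. $\mathcal E^{0,r}_{\{\mathcal M\}}$, $\mathcal E^{0,r}_{(\mathcal M)}$ are the corresponding spaces of germs at $0\in\mathbb R^r$ (functions in the class on some cube $(-1/k,1/k)^r$). For $\mathbf b=(b_\alpha)_{\alpha\in\mathbb N^r}$, a weight sequence $N$, $h>0$: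 $|\mathbf b|^N_h:=\sup_\alpha|b_\alpha|/(h^{|\alpha|}n_{|\alpha|})$; $\Lambda^r_{\{\mathcal N\}}:=\{\mathbf b:\exists\lambda>0\,\exists h>0,\ |\mathbf b|^{N^{(\lambda)}}_h<\infty\}$, $\Lambda^r_{(\mathcal N)}:=\{\mathbf b:\forall\lambda>0\,\forall h>0,\ |\mathbf b|^{N^{(\lambda)}}_h<\infty\}$. The Borel map is $j^\infty(f)=(\partial^\alpha f(0)/|\alpha|!)_{\alpha\in\mathbb N^r}$. $[\cdot]$ means $\{\cdot\}$ throughout or $(\cdot)$ throughout. *)

(* Defs.v *)
From Stdlib Require Import Reals Arith.
Open Scope R_scope.

Definition small (M : nat -> R) (p : nat) : R := M p / INR (fact p).

Definition weight_sequence (M : nat -> R) : Prop :=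
  (forall p, 0 < M p) /\
  M 0%nat = 1 /\ 1 <= M 1%nat /\
  (forall p, (1 <= p)%nat -> (M p) ^ 2 <= M (p - 1)%nat * M (p + 1)%nat) /\
  (exists c, 0 < c /\ exists P, forall p, (P <= p)%nat -> (1 <= p)%nat ->
       c <= Rpower (small M p) (/ INR p)).

(* sum_{p>=1} M_{p-1}/M_p = +oo  (partial sums unbounded; terms are positive) *)
Definition quasianalytic (M : nat -> R) : Prop :=
  forall B : R, exists n : nat, B < sum_f_R0 (fun k => M k / M (S k)) n.

Definition weight_matrix (M : R -> nat -> R) : Prop :=
  (forall lam, 0 < lam -> weight_sequence (M lam)) /\
  (forall lam kap, 0 < lam -> lam <= kap -> forall p, M lam p <= M kap p).

Definition quasianalytic_matrix (M : R -> nat -> R) : Prop :=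
  forall lam, 0 < lam -> quasianalytic (M lam).

Definition inRr (r : nat) (x : nat -> R) : Prop := forall i, (r <= i)%nat -> x i = 0.

Definition multi_index (r : nat) (a : nat -> nat) : Prop :=
  forall i, (r <= i)%nat -> a i = 0%nat.

Fixpoint mlen (r : nat) (a : nat -> nat) : nat :=
  match r with O => O | S r' => (a r' + mlen r' a)%nat end.

Definition mzero : nat -> nat := fun _ => 0%nat.
Definition incr (a : nat -> nat) (i : nat) : nat -> nat :=
  fun j => if Nat.eqb j i then S (a j) else a j.
Definition upd (x : nat -> R) (i : nat) (t : R) : nat -> R :=
  fun j => if Nat.eqb j i then t else x j.
Definition origin : nat -> R := fun _ => 0.

Definition open_cube (r k : nat) (x : nat -> R) : Prop :=
  inRr r x /\ forall i, (i < r)%nat -> Rabs (x i) < / INR k.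
Definition closed_cube (r : nat) (c : R) (x : nat -> R) : Prop :=
  inRr r x /\ forall i, (i < r)%nat -> Rabs (x i) <= c.

Definition cont_on (r : nat) (S : (nat -> R) -> Prop) (g : (nat -> R) -> R) : Prop :=
  forall x, S x -> forall eps, 0 < eps -> exists delta, 0 < delta /\
    forall y, S y -> (forall i, (i < r)%nat -> Rabs (y i - x i) < delta) ->
      Rabs (g y - g x) < eps.

Definition smooth_with_derivs (r : nat) (U : (nat -> R) -> Prop)
    (f : (nat -> R) -> R) (D : (nat -> nat) -> (nat -> R) -> R) : Prop :=
  (forall x, U x -> D mzero x = f x) /\
  (forall a, multi_index r a -> cont_on r U (D a)) /\
  (forall a, multi_index r a -> forall i, (i < r)%nat -> forall x, U x ->
     derivable_pt_lim (fun t => D a (upd x i t)) (x i) (D (incr a i) x)).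

Definition norm_finite (r : nat) (K : (nat -> R) -> Prop)
    (D : (nat -> nat) -> (nat -> R) -> R) (M : nat -> R) (h : R) : Prop :=
  exists C, forall a, multi_index r a -> forall x, K x ->
    Rabs (D a x) <= C * h ^ (mlen r a) * M (mlen r a).

(* Compact subsets K of the open cube (-1/k,1/k)^r are exactly the subsets of
   the closed cubes [-c,c]^r, 0 < c < 1/k; the seminorm condition is monotone
   in K, so it suffices to quantify over these closed cubes. *)

Definition in_E_Roumieu (r k : nat) (M : R -> nat -> R) (f : (nat -> R) -> R) D : Prop :=
  smooth_with_derivs r (open_cube r k) f D /\
  forall c, 0 < c -> c < / INR k ->
    exists lam, 0 < lam /\ exists h, 0 < h /\ norm_finite r (closed_cube r c) D (M lam) h.

Definition in_E_Beurling (r k : nat) (M : R -> nat -> R) (f : (nat -> R) -> R) D : Prop :=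
  smooth_with_derivs r (open_cube r k) f D /\
  forall c, 0 < c -> c < / INR k ->
    forall lam, 0 < lam -> forall h, 0 < h -> norm_finite r (closed_cube r c) D (M lam) h.

Definition jet_eq (r : nat) (D : (nat -> nat) -> (nat -> R) -> R) (b : (nat -> nat) -> R) : Prop :=
  forall a, multi_index r a -> b a = D a origin / INR (fact (mlen r a)).

Definition jet_image_Roumieu (r : nat) (M : R -> nat -> R) (b : (nat -> nat) -> R) : Prop :=
  exists k f D, (1 <= k)%nat /\ in_E_Roumieu r k M f D /\ jet_eq r D b.

Definition jet_image_Beurling (r : nat) (M : R -> nat -> R) (b : (nat -> nat) -> R) : Prop :=
  exists k f D, (1 <= k)%nat /\ in_E_Beurling r k M f D /\ jet_eq r D b.

Definition seq_norm_finite (r : nat) (N : nat -> R) (h : R) (b : (nat -> nat) -> R) : Prop :=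
  exists C, forall a, multi_index r a ->
    Rabs (b a) <= C * h ^ (mlen r a) * small N (mlen r a).

Definition Lambda_Roumieu (r : nat) (N : R -> nat -> R) (b : (nat -> nat) -> R) : Prop :=
  exists lam, 0 < lam /\ exists h, 0 < h /\ seq_norm_finite r (N lam) h b.

Definition Lambda_Beurling (r : nat) (N : R -> nat -> R) (b : (nat -> nat) -> R) : Prop :=
  forall lam, 0 < lam -> forall h, 0 < h -> seq_norm_finite r (N lam) h b.

(* Main.v *)
(** A jet [b] with nonnegative entries and divergent power series is never the
    jet of a quasianalytic germ.  Restrict the germ to the first axis and let
    [F p] be the [p]-th derivative, bounded by [A p] on [[0, c]].  Bang's
    method, applied to negative parts only, shows that [F p 0 >= 0] for all [p]
    forces [F p >= 0] on [[0, c]]: if [F j >= - e^(j-k-1) A j] for all [j] at a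
    point, then [F j >= - e^(j-k) A j] for all [j] on the interval of length
    [A k / (e A (k+1))] to its right.  These lengths have a divergent sum, so
    every point is reached from [0] starting with an arbitrarily small bound.
    Taylor's formula then gives [F p 0 * c^p / p! <= F 0 c], so the jet
    converges.  In the Roumieu case [b = n^(1)] diverges; in the Beurling case
    take [b_k = J(k)^k] with [J] tending to infinity slowly enough. *)

Require Import Defs.
From Stdlib Require Import Reals Arith Lra Lia.
From Stdlib Require Import FunctionalExtensionality ClassicalEpsilon.
From Coquelicot Require Import Coquelicot.
Open Scope R_scope.

(** * Monotonicity and log-convexity *)

Lemma nonneg_derivative_le (f f' : R -> R) (a b : R) :
  a <= b ->
  (forall t, a <= t <= b -> derivable_pt_lim f t (f' t)) ->
  (forall t, a <= t <= b -> 0 <= f' t) ->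
  f a <= f b.
Proof.
  intros [Hab | ->] Hd Hp; [| lra].
  destruct (MVT_cor2 f f' a b Hab Hd) as [t [Ht Hin]].
  assert (0 <= f' t) by (apply Hp; lra).
  nra.
Qed.

Lemma exp_le (x y : R) : x <= y -> exp x <= exp y.
Proof. intros [H | ->]; [left; now apply exp_increasing | lra]. Qed.

Lemma log_convex_ratio (A : nat -> R) :
  (forall p, 0 < A p) ->
  (forall p, A (S p) ^ 2 <= A p * A (S (S p))) ->
  forall j k, (j <= k)%nat -> A (S j) / A j <= A (S k) / A k.
Proof.
  intros HA Hc j k Hjk; induction Hjk as [| k Hjk IH]; [lra |].
  apply Rle_trans with (1 := IH).
  apply Rle_div_l; [apply HA |].
  replace (A (S (S k)) / A (S k) * A k) with (A k * A (S (S k)) / A (S k))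
    by (field; apply Rgt_not_eq, HA).
  apply Rle_div_r; [apply HA |].
  specialize (Hc k); lra.
Qed.

(** * Bang's method for negative parts *)

Section Bang.

Variables (A : nat -> R) (c : R) (F : nat -> R -> R).
Hypothesis A_pos : forall p, 0 < A p.
Hypothesis A_log_convex : forall p, A (S p) ^ 2 <= A p * A (S (S p)).
Hypothesis F_deriv : forall p t, 0 <= t <= c -> derivable_pt_lim (F p) t (F (S p) t).
Hypothesis F_bound : forall p t, 0 <= t <= c -> Rabs (F p t) <= A p.

(** One-sided form of Bang's weighted sup norm: [exp u] bounds the negative parts of the [F j x]
    relative to the weights [exp (INR j) * A j]. *)
Definition negpart_le (x u : R) : Prop :=
  forall j, - (exp (u + INR j) * A j) <= F j x.

Lemma negpart_le_trivial (j k : nat) (t : R) :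
  0 <= t <= c -> (k <= j)%nat -> - (exp (- INR k + INR j) * A j) <= F j t.
Proof.
  intros Ht Hkj.
  generalize (F_bound j t Ht); intros H; apply Rabs_le_between in H.
  assert (1 <= exp (- INR k + INR j)).
  { rewrite <- exp_0; apply exp_le; apply le_INR in Hkj; lra. }
  specialize (A_pos j); nra.
Qed.

(** For [j <= k], log-convexity gives [A (S j) <= mu * A j], so moving right multiplies the bound by
    at most [exp (exp 1 * mu * (x - z))]. The allowed step keeps this factor below or at [exp 1],
    which costs one unit in the exponent. For [j >= k] the bound is trivial. *)
Lemma negpart_growth (k : nat) (z x : R) :
  0 <= z -> z <= x -> x <= c ->
  negpart_le z (- INR (S k)) ->
  exp 1 * (x - z) <= A k / A (S k) ->
  negpart_le x (- INR k).
Proof.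
  intros Hz Hzx Hxc Hneg Hstep.
  set (mu := A (S k) / A k).
  assert (Hmu : 0 < mu) by (apply Rdiv_lt_0_compat; apply A_pos).
  assert (He : 0 < exp 1) by apply exp_pos.
  (* Descending induction on [j]: the bound for [F (j+1)], the derivative of
     [F j], integrates to the bound for [F j]. *)
  assert (H : forall d j, (j + d = S k)%nat -> forall t, z <= t <= x ->
    - (exp (- INR (S k) + INR j) * A j * exp (exp 1 * mu * (t - z))) <= F j t).
  { induction d as [| d IH]; intros j Hj t Ht.
    - assert (Htr := negpart_le_trivial j (S k) t ltac:(lra) ltac:(lia)).
      assert (1 <= exp (exp 1 * mu * (t - z))).
      { rewrite <- exp_0 at 1; apply exp_le.
        apply Rmult_le_pos; [nra | lra]. }
      assert (0 < exp (- INR (S k) + INR j) * A j)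
        by (apply Rmult_lt_0_compat; [apply exp_pos | apply A_pos]).
      nra.
    - set (K := exp (- INR (S k) + INR j) * A j).
      assert (HK : 0 < K)
        by (apply Rmult_lt_0_compat; [apply exp_pos | apply A_pos]).
      (* The added exponential compensates any decrease of [F j]: by the bound on [F (S j)] the sum
         is nondecreasing. *)
      assert (Hmono :
        F j z + K * exp (exp 1 * mu * (z - z)) <=
        F j t + K * exp (exp 1 * mu * (t - z))).
      { apply nonneg_derivative_le with
          (f := fun s => F j s + K * exp (exp 1 * mu * (s - z)))
          (f' := fun s => F (S j) s + K * (exp 1 * mu * exp (exp 1 * mu * (s - z))));
          [lra | |]; intros s Hs.
        - apply derivable_pt_lim_plus; [apply F_deriv; lra |].
          apply is_derive_Reals; auto_derive; [easy | unfold Rminus; ring].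
        - assert (HS := IH (S j) ltac:(lia) s ltac:(lra)).
          enough (exp (- INR (S k) + INR (S j)) * A (S j) <= K * (exp 1 * mu)).
          { assert (0 < exp (exp 1 * mu * (s - z))) by apply exp_pos. nra. }
          replace (- INR (S k) + INR (S j)) with (- INR (S k) + INR j + 1)
            by (rewrite (S_INR j); ring).
          rewrite exp_plus.
          assert (Hr := log_convex_ratio A A_pos A_log_convex j k ltac:(lia)).
          fold mu in Hr; apply (proj1 (Rle_div_l _ _ _ (A_pos j))) in Hr.
          unfold K.
          assert (0 < exp (- INR (S k) + INR j) * exp 1)
            by (apply Rmult_lt_0_compat; apply exp_pos).
          nra. }
      rewrite Rminus_diag, Rmult_0_r, exp_0, Rmult_1_r in Hmono.
      specialize (Hneg j); fold K in Hneg; lra. }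
  intros j; destruct (le_lt_dec k j) as [Hkj | Hkj].
  - apply negpart_le_trivial; [lra | easy].
  - specialize (H (S k - j)%nat j ltac:(lia) x ltac:(lra)).
    apply Rle_trans with (2 := H), Ropp_le_contravar.
    replace (- INR k + INR j) with (- INR (S k) + INR j + 1)
      by (rewrite S_INR; ring).
    rewrite (exp_plus (_ + _)).
    assert (exp (exp 1 * mu * (x - z)) <= exp 1).
    { apply exp_le.
      apply Rle_trans with (mu * (A k / A (S k))).
      - replace (exp 1 * mu * (x - z)) with (mu * (exp 1 * (x - z))) by ring.
        apply Rmult_le_compat_l; lra.
      - right; unfold mu; field; split; apply Rgt_not_eq, A_pos. }
    assert (0 < exp (- INR (S k) + INR j) * A j)
      by (apply Rmult_lt_0_compat; [apply exp_pos | apply A_pos]).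
    nra.
Qed.

Hypothesis F_0_ge0 : forall p, 0 <= F p 0.

(** Nonnegativity at 0 makes every level [u] available there, however negative. *)
Lemma negpart_le_0 (u : R) : negpart_le 0 u.
Proof.
  intros j; specialize (F_0_ge0 j).
  assert (0 < exp (u + INR j) * A j)
    by (apply Rmult_lt_0_compat; [apply exp_pos | apply A_pos]).
  lra.
Qed.

(** Start at 0 with level [- INR (S (k + d))] and walk right, each step raising the level by one.
    The induction on [d] peels off the last step, the one of index [k]. *)
Lemma negpart_le_reach (d k : nat) (x : R) :
  0 <= x <= c ->
  exp 1 * x <= sum_f_R0 (fun i => A (k + i)%nat / A (S (k + i))) d ->
  negpart_le x (- INR k).
Proof.
  revert k x; induction d as [| d IH]; intros k x Hx Hsum.
  - simpl in Hsum; rewrite Nat.add_0_r in Hsum.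
    apply negpart_growth with 0; try lra; apply negpart_le_0.
  - rewrite decomp_sum in Hsum by lia; simpl pred in Hsum.
    rewrite Nat.add_0_r in Hsum.
    set (s := sum_f_R0 _ d) in Hsum.
    assert (Hs : s = sum_f_R0 (fun i => A (S k + i)%nat / A (S (S k + i))) d).
    { apply sum_eq; intros i _; now rewrite Nat.add_succ_r. }
    assert (He : 0 < exp 1) by apply exp_pos.
    assert (Hes : exp 1 * (s / exp 1) = s) by (field; lra).
    assert (Hs0 : 0 <= s).
    { rewrite Hs; apply cond_pos_sum; intros i; left.
      apply Rdiv_lt_0_compat; apply A_pos. }
    (* [s / exp 1] is the total length of all steps but the last; the minimum covers an [x] already
       within their reach. *)
    apply negpart_growth with (Rmin x (s / exp 1)).
    + apply Rmin_glb; [lra |].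
      now apply Rdiv_le_0_compat.
    + apply Rmin_l.
    + lra.
    + apply IH; [split; [apply Rmin_glb; [lra |]; now apply Rdiv_le_0_compat |] |].
      * apply Rle_trans with x; [apply Rmin_l | lra].
      * rewrite <- Hs; apply Rle_trans with (exp 1 * (s / exp 1)); [| lra].
        apply Rmult_le_compat_l; [lra | apply Rmin_r].
    + unfold Rmin; destruct Rle_dec; [| lra].
      replace (exp 1 * (x - x)) with 0 by ring.
      left; apply Rdiv_lt_0_compat; apply A_pos.
Qed.

Lemma bang_nonneg :
  quasianalytic A -> forall p t, 0 <= t <= c -> 0 <= F p t.
Proof.
  intros Hq p t Ht.
  assert (Hall : forall k, negpart_le t (- INR k)).
  { intros k.
    (* Exceeding the partial sum up to [k] by [exp 1 * t] forces [n > k] and leaves a block from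
       [S k] to [n] long enough to reach [t]. *)
    destruct (Hq (exp 1 * t + sum_f_R0 (fun i => A i / A (S i)) k)) as [n Hn].
    assert (Hkn : (k < n)%nat).
    { destruct (le_lt_dec n k) as [Hnk |]; [exfalso | easy].
      assert (0 < exp 1) by apply exp_pos.
      destruct (Nat.eq_dec n k) as [-> | Hne]; [nra |].
      rewrite (tech2 _ n k) in Hn by lia.
      assert (0 <= sum_f_R0 (fun i => A (S n + i)%nat / A (S (S n + i))) (k - S n)).
      { apply cond_pos_sum; intros i; left; apply Rdiv_lt_0_compat; apply A_pos. }
      nra. }
    rewrite (tech2 _ k n Hkn) in Hn.
    assert (Hr : negpart_le t (- INR (S k))).
    { apply negpart_le_reach with (n - S k)%nat; [easy | lra]. }
    intros j; apply Rle_trans with (2 := Hr j), Ropp_le_contravar.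
    apply Rmult_le_compat_r; [left; apply A_pos |].
    apply exp_le; rewrite S_INR; lra. }
  destruct (Rle_lt_dec 0 (F p t)) as [| Hneg]; [easy | exfalso].
  assert (HA := A_pos p).
  assert (HE := exp_pos (INR p)).
  (* The negative part of [F p t] relative to its weight: positive by assumption, yet at most
     [exp (- INR k)] for every [k]. *)
  set (q := - F p t / (exp (INR p) * A p)).
  assert (Hq0 : 0 < q) by (apply Rdiv_lt_0_compat; nra).
  destruct (INR_unbounded (- ln q)) as [k Hk].
  specialize (Hall k p); rewrite exp_plus in Hall.
  assert (Hlt : exp (- INR k) < q).
  { rewrite <- (exp_ln q Hq0); apply exp_increasing; lra. }
  assert (q * (exp (INR p) * A p) = - F p t) by (unfold q; field; lra).
  nra.
Qed.

End Bang.

(** * Taylor terms under nonnegative derivatives *)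

Lemma taylor_term_le (n : nat) : forall (F : nat -> R -> R) (c : R),
  (forall p t, 0 <= t <= c -> derivable_pt_lim (F p) t (F (S p) t)) ->
  (forall p t, 0 <= t <= c -> 0 <= F p t) ->
  forall t, 0 <= t <= c -> F n 0 / INR (fact n) * t ^ n <= F 0%nat t.
Proof.
  induction n as [| n IH]; intros F c Hd Hp t Ht.
  - simpl; replace (F 0%nat 0 / 1 * 1) with (F 0%nat 0) by field.
    apply nonneg_derivative_le with (f' := F 1%nat); [lra | |];
      intros s Hs; [apply Hd | apply Hp]; lra.
  - set (K := F (S n) 0 / INR (fact (S n))).
    (* Subtracting the monomial leaves a nondecreasing function: its derivative is nonnegative by
       the induction hypothesis for the shifted family, which is why [F] is quantified after [n]. *)
    assert (Hm : F 0%nat 0 - K * 0 ^ S n <= F 0%nat t - K * t ^ S n).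
    { apply nonneg_derivative_le with
        (f := fun s => F 0%nat s - K * s ^ S n)
        (f' := fun s => F 1%nat s - F (S n) 0 / INR (fact n) * s ^ n);
        [lra | |]; intros s Hs.
      - apply derivable_pt_lim_minus; [apply Hd; lra |].
        apply is_derive_Reals; auto_derive; [easy |].
        unfold K; rewrite fact_simpl, mult_INR.
        change (match n with O => 1 | S _ => INR n + 1 end) with (INR (S n)).
        simpl pred; field; split; [apply INR_fact_neq_0 | now apply not_0_INR].
      - assert (H := IH (fun p => F (S p)) c
          (fun p => Hd (S p)) (fun p => Hp (S p)) s ltac:(lra)).
        simpl in H |- *; lra. }
    rewrite pow_ne_zero, Rmult_0_r in Hm by easy.
    specialize (Hp 0%nat 0 ltac:(lra)); lra.
Qed.

(** * Divergent jets and restriction to the first axis *)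

(** For nonnegative [s]: the power series with coefficients [s p] has radius of convergence 0. *)
Definition divergent (s : nat -> R) : Prop :=
  forall C rho, 0 < C -> 0 < rho -> exists p, C * rho ^ p < s p.

(** Building the multi-index (p,0,...,0) by [incr] makes [D (axis_index (S p))] literally the
    partial derivative given by [smooth_with_derivs]. *)
Fixpoint axis_index (p : nat) : nat -> nat :=
  match p with O => mzero | S q => incr (axis_index q) 0 end.

Lemma multi_index_axis (r p : nat) : (1 <= r)%nat -> multi_index r (axis_index p).
Proof.
  intros Hr; induction p as [| p IH]; intros i Hi; [easy |].
  simpl; unfold incr; destruct (Nat.eqb_spec i 0); [lia | now apply IH].
Qed.

Lemma mlen_axis (r p : nat) : (1 <= r)%nat -> mlen r (axis_index p) = p.
Proof.
  intros Hr.
  assert (H0 : axis_index p 0%nat = p).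
  { induction p as [| p IH]; [easy |]. simpl; unfold incr; simpl; now rewrite IH. }
  assert (Hm := multi_index_axis 1 p (le_n 1)).
  induction r as [| r IH]; [lia |].
  destruct r as [| r]; simpl; [rewrite H0; lia |].
  simpl in IH; rewrite IH by lia; rewrite (Hm (S r)); lia.
Qed.

Lemma upd_upd (x : nat -> R) (i : nat) (s t : R) : upd (upd x i s) i t = upd x i t.
Proof.
  apply functional_extensionality; intros j; unfold upd.
  now destruct (Nat.eqb j i).
Qed.

(** Nonnegativity propagates along the axis by [bang_nonneg], so every Taylor term [s p * c ^ p] is
    at most [F 0 c <= A 0]; divergence with [rho = / c] contradicts this. *)
Lemma divergent_not_jet (r : nat) (M : R -> nat -> R) (s : nat -> R) :
  (1 <= r)%nat -> weight_matrix M -> quasianalytic_matrix M ->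
  (forall p, 0 <= s p) -> divergent s ->
  ~ jet_image_Roumieu r M (fun a => s (mlen r a)).
Proof.
  intros Hr [HM _] HMq Hs Hdiv (k & f & D & Hk & [[_ [_ Hder]] HE] & Hjet).
  assert (HkR : 0 < INR k) by (apply lt_0_INR; lia).
  assert (Hik := Rinv_0_lt_compat _ HkR).
  set (c := / INR k / 2).
  assert (Hc : 0 < c < / INR k) by (unfold c; lra).
  destruct (HE c (proj1 Hc) (proj2 Hc)) as (lam & Hlam & h & Hh & C & HC).
  destruct (HM lam Hlam) as (Mpos & _ & _ & Mlc & _).
  (* The constant [C] may be nonpositive, while [A] has to be positive. *)
  set (C' := Rmax C 1).
  assert (HC' : 0 < C') by (apply Rlt_le_trans with 1; [lra | apply Rmax_r]).
  set (A := fun p => C' * h ^ p * M lam p).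
  set (F := fun p t => D (axis_index p) (upd origin 0 t)).
  assert (Hhp : forall p, 0 < h ^ p) by (intros p; now apply pow_lt).
  assert (A_pos : forall p, 0 < A p).
  { intros p; unfold A; repeat apply Rmult_lt_0_compat; auto. }
  assert (Hin : forall t b, Rabs t <= b ->
    forall i, (i < r)%nat -> Rabs (upd origin 0 t i) <= b).
  { intros t b Hb i _; unfold upd, origin; destruct (Nat.eqb i 0); [easy |].
    rewrite Rabs_R0; apply Rle_trans with (2 := Hb), Rabs_pos. }
  assert (HinR : forall t, inRr r (upd origin 0 t)).
  { intros t i Hi; unfold upd, origin; destruct (Nat.eqb_spec i 0); [lia | easy]. }
  assert (F_deriv : forall p t, 0 <= t <= c -> derivable_pt_lim (F p) t (F (S p) t)).
  { intros p t Ht.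
    assert (HU : open_cube r k (upd origin 0 t)).
    { split; [apply HinR |]; intros i Hi.
      apply Rle_lt_trans with c; [| easy].
      apply Hin; [rewrite Rabs_pos_eq; lra | easy]. }
    assert (H := Hder (axis_index p) (multi_index_axis r p Hr) 0%nat ltac:(lia) _ HU).
    unfold F; simpl.
    replace (fun s => D (axis_index p) (upd (upd origin 0 t) 0 s))
      with (fun s => D (axis_index p) (upd origin 0 s)) in H
      by (apply functional_extensionality; intros u; now rewrite upd_upd).
    exact H. }
  assert (F_bound : forall p t, 0 <= t <= c -> Rabs (F p t) <= A p).
  { intros p t Ht; unfold F, A.
    assert (HK : closed_cube r c (upd origin 0 t)).
    { split; [apply HinR |]. apply Hin; rewrite Rabs_pos_eq; lra. }
    assert (H := HC (axis_index p) (multi_index_axis r p Hr) _ HK).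
    rewrite (mlen_axis r p Hr) in H.
    apply Rle_trans with (1 := H).
    repeat apply Rmult_le_compat_r; [left; auto | left; auto | apply Rmax_l]. }
  assert (F_0 : forall p, F p 0 = s p * INR (fact p)).
  { intros p; unfold F.
    replace (upd origin 0 0) with origin
      by (apply functional_extensionality; intros i; unfold upd, origin;
          now destruct (Nat.eqb i 0)).
    assert (H := Hjet (axis_index p) (multi_index_axis r p Hr)).
    cbv beta in H; rewrite (mlen_axis r p Hr) in H.
    rewrite H; field; apply INR_fact_neq_0. }
  assert (A_lc : forall p, A (S p) ^ 2 <= A p * A (S (S p))).
  { intros p; unfold A.
    assert (H := Mlc (S p) ltac:(lia)).
    replace (S p - 1)%nat with p in H by lia.
    replace (S p + 1)%nat with (S (S p)) in H by lia.
    replace ((C' * h ^ S p * M lam (S p)) ^ 2)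
      with ((C' * h ^ S p) ^ 2 * M lam (S p) ^ 2) by ring.
    replace (C' * h ^ p * M lam p * (C' * h ^ S (S p) * M lam (S (S p))))
      with ((C' * h ^ S p) ^ 2 * (M lam p * M lam (S (S p)))) by (simpl; ring).
    apply Rmult_le_compat_l; [apply pow2_ge_0 | easy]. }
  assert (A_q : quasianalytic A).
  (* The ratios of [A] are [/ h] times those of [M lam], so the bound [B] is scaled by [h]. *)
  { intros B; destruct (HMq lam Hlam (h * B)) as [n Hn]; exists n.
    apply Rmult_lt_reg_l with h; [easy |].
    rewrite scal_sum.
    replace (sum_f_R0 _ n) with (sum_f_R0 (fun i => M lam i / M lam (S i)) n); [easy |].
    apply sum_eq; intros i _; unfold A; simpl.
    assert (Hi := Hhp i); assert (Hi' := Mpos (S i)); field.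
    repeat split; lra. }
  assert (F_0_ge0 : forall p, 0 <= F p 0).
  { intros p; rewrite F_0; apply Rmult_le_pos; [auto | apply pos_INR]. }
  assert (F_ge0 := bang_nonneg A c F A_pos A_lc F_deriv F_bound F_0_ge0 A_q).
  destruct (Hdiv (A 0%nat) (/ c)) as [p Hp];
    [apply A_pos | apply Rinv_0_lt_compat; lra |].
  assert (HT := taylor_term_le p F c F_deriv F_ge0 c ltac:(lra)).
  rewrite F_0 in HT.
  replace (s p * INR (fact p) / INR (fact p)) with (s p) in HT
    by (field; apply INR_fact_neq_0).
  assert (HB := F_bound 0%nat c ltac:(lra)).
  rewrite Rabs_pos_eq in HB by (apply F_ge0; lra).
  assert (Hcp : 0 < c ^ p) by (apply pow_lt; lra).
  rewrite pow_inv in Hp.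
  apply (Rmult_lt_compat_r (c ^ p)) in Hp; [| easy].
  rewrite Rmult_assoc, Rinv_l in Hp by lra.
  lra.
Qed.

Lemma jet_image_Beurling_Roumieu (r : nat) (M : R -> nat -> R) (b : (nat -> nat) -> R) :
  jet_image_Beurling r M b -> jet_image_Roumieu r M b.
Proof.
  intros (k & f & D & Hk & [Hs HE] & Hj); exists k, f, D.
  repeat split; try easy; try apply Hs.
  intros c Hc Hck; exists 1; split; [lra |]; exists 1; split; [lra |].
  apply HE; auto; lra.
Qed.

(** * Divergent members of the sequence spaces *)

Lemma pow_lt_of_root (B x : R) (k : nat) :
  0 < B -> 0 < x -> (1 <= k)%nat -> B < Rpower x (/ INR k) -> B ^ k < x.
Proof.
  intros HB Hx Hk H.
  assert (HkR : 0 < INR k) by (apply lt_0_INR; lia).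
  rewrite <- Rpower_pow by easy.
  replace x with (Rpower (Rpower x (/ INR k)) (INR k)) at 1.
  - apply Rlt_Rpower_l; lra.
  - rewrite Rpower_mult, Rinv_l, Rpower_1 by lra; easy.
Qed.

Lemma divergent_of_root_unbounded (s : nat -> R) :
  (forall B, 0 < B -> exists k, (1 <= k)%nat /\ B ^ k <= s k) -> divergent s.
Proof.
  intros H C rho HC Hrho.
  (* This base absorbs the constant: [C < C + 1 <= (C + 1) ^ k] for [k >= 1]. *)
  set (C' := C + 1).
  assert (HC1 : 1 <= C') by (unfold C'; lra).
  destruct (H (C' * rho)) as (k & Hk & Hs); [unfold C'; nra |].
  exists k; apply Rlt_le_trans with (2 := Hs).
  rewrite Rpow_mult_distr; apply Rmult_lt_compat_r; [now apply pow_lt |].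
  apply Rlt_le_trans with C'; [unfold C'; lra |].
  rewrite <- (pow_1 C') at 1; now apply Rle_pow.
Qed.

Lemma small_pos (N : nat -> R) (p : nat) : weight_sequence N -> 0 < small N p.
Proof.
  intros [HN _]; apply Rdiv_lt_0_compat; [apply HN | apply INR_fact_lt_0].
Qed.

(* [J] increases by one as soon as the condition for the next value holds. *)
Lemma slow_diagonal (P : nat -> nat -> Prop) :
  (forall j, exists K, forall k, (K <= k)%nat -> P j k) ->
  exists J : nat -> nat,
    (forall k, J k <> 0%nat -> P (J k) k) /\
    (forall j, exists K, forall k, (K <= k)%nat -> (j <= J k)%nat).
Proof.
  intros HP.
  (* Asking for [P j] at all indices from [k] on keeps the condition valid while [J] stays
     constant. *)
  set (G := fun j k => forall q, (k <= q)%nat -> P j q).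
  set (J := fix J k := match k with
    | O => O
    | S k' => if excluded_middle_informative (G (S (J k')) k) then S (J k') else J k'
    end).
  assert (Jmono : forall k l, (k <= l)%nat -> (J k <= J l)%nat).
  { intros k l H; induction H as [| l _ IH]; [easy |].
    simpl; destruct excluded_middle_informative; lia. }
  exists J; split.
  - assert (HG : forall k, J k <> 0%nat -> G (J k) k).
    { induction k as [| k IH]; [easy |]; simpl.
      destruct excluded_middle_informative as [g |]; [easy |].
      intros H q Hq; apply (IH H); lia. }
    intros k Hk; now apply HG.
  - induction j as [| j [K IH]]; [exists 0%nat; lia |].
    destruct (HP (S j)) as [K' HK'].
    exists (S (K + K')); intros k Hk.
    apply Nat.le_trans with (J (S (K + K'))); [| now apply Jmono].
    assert (HJ := IH (K + K')%nat ltac:(lia)).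
    simpl; destruct excluded_middle_informative as [| n]; [lia |].
    destruct (Nat.eq_dec (J (K + K')%nat) j) as [E | E]; [| lia].
    exfalso; apply n; rewrite E; intros q Hq; apply HK'; lia.
Qed.

Lemma le_multiple_of_eventually_le (u v : nat -> R) (K : nat) :
  (forall k, 0 < v k) ->
  forall C0, (forall k, (K <= k)%nat -> u k <= C0 * v k) ->
  exists C, forall k, u k <= C * v k.
Proof.
  intros Hv; induction K as [| K IH]; intros C0 H.
  - exists C0; intros k; apply H; lia.
  - apply (IH (Rmax C0 (u K / v K))); intros k Hk.
    assert (Hvk := Hv k).
    destruct (Nat.eq_dec k K) as [-> | Hne].
    + apply Rle_div_l; [easy | apply Rmax_r].
    + apply Rle_trans with (C0 * v k); [apply H; lia |].
      apply Rmult_le_compat_r; [lra | apply Rmax_l].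
Qed.

Lemma Lambda_Beurling_divergent (r : nat) (N : R -> nat -> R) :
  weight_matrix N ->
  (forall lam, 0 < lam -> forall B : R, exists K, forall k, (K <= k)%nat -> (1 <= k)%nat ->
     B < Rpower (small (N lam) k) (/ INR k)) ->
  exists s, (forall p, 0 <= s p) /\ divergent s /\
    Lambda_Beurling r N (fun a => s (mlen r a)).
Proof.
  intros [HN Nmono] Hlim.
  (* Of the squared factor, one copy of [j] bounds the jet entry and the other absorbs any [h]. The
     parameter [/ INR j] eventually falls below any [lam]; the guard excludes [/ 0]. *)
  destruct (slow_diagonal (fun j k =>
    j <> 0%nat -> (INR j * INR j) ^ k <= small (N (/ INR j)) k)) as (J & HJ & Junb).
  { intros [| j]; [exists 0%nat; easy |].
    assert (Hj : 0 < INR (S j)) by (apply lt_0_INR; lia).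
    assert (Hij := Rinv_0_lt_compat _ Hj).
    destruct (Hlim _ Hij (INR (S j) * INR (S j))) as [K HK].
    exists (S K); intros k Hk _; left.
    apply pow_lt_of_root; [nra | now apply small_pos, HN | lia | apply HK; lia]. }
  exists (fun k => INR (J k) ^ k).
  split; [intros p; apply pow_le, pos_INR | split].
  - apply divergent_of_root_unbounded; intros B HB.
    destruct (INR_unbounded B) as [j Hj].
    destruct (Junb j) as [K HK].
    exists (S K); split; [lia |].
    apply pow_incr; split; [lra |].
    apply Rle_trans with (INR j); [lra | apply le_INR, HK; lia].
  - intros lam Hlam h Hh.
    (* Once [J k >= j], both [/ INR (J k) < lam] and [h * INR (J k) > 1] hold. *)
    destruct (INR_unbounded (/ lam + / h)) as [j Hj].
    assert (Hil := Rinv_0_lt_compat _ Hlam).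
    assert (Hih := Rinv_0_lt_compat _ Hh).
    destruct (Junb j) as [K HK].
    destruct (le_multiple_of_eventually_le (fun k => INR (J k) ^ k)
      (fun k => h ^ k * small (N lam) k) K) with (C0 := 1) as [C HC].
    + intros k; apply Rmult_lt_0_compat; [now apply pow_lt | now apply small_pos, HN].
    + intros k Hk; rewrite Rmult_1_l.
      assert (HjJ : INR j <= INR (J k)) by (now apply le_INR, HK).
      assert (HJ0 : 0 < INR (J k)) by lra.
      assert (HJn : J k <> 0%nat) by (intros E; rewrite E in HJ0; simpl in HJ0; lra).
      assert (HJi := Rinv_0_lt_compat _ HJ0).
      assert (HP := HJ k HJn HJn).
      assert (Hsm : small (N (/ INR (J k))) k <= small (N lam) k).
      { apply Rmult_le_compat_r; [left; apply Rinv_0_lt_compat, INR_fact_lt_0 |].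
        apply Nmono; [easy |].
        rewrite <- (Rinv_inv lam); apply Rinv_le_contravar; lra. }
      apply Rle_trans with (h ^ k * (INR (J k) * INR (J k)) ^ k).
      * rewrite <- Rpow_mult_distr; apply pow_incr; split; [lra |].
        assert (1 <= h * INR (J k)).
        { rewrite <- (Rinv_r h) by lra; apply Rmult_le_compat_l; lra. }
        nra.
      * apply Rmult_le_compat_l; [left; now apply pow_lt | lra].
    + exists C; intros a _.
      rewrite Rabs_pos_eq by (apply pow_le, pos_INR).
      rewrite Rmult_assoc; apply HC.
Qed.

Lemma Lambda_Roumieu_divergent (r : nat) (N : R -> nat -> R) :
  weight_matrix N ->
  (forall lam, 0 < lam -> forall B : R,
     exists k, (1 <= k)%nat /\ B < Rpower (small (N lam) k) (/ INR k)) ->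
  exists s, (forall p, 0 <= s p) /\ divergent s /\
    Lambda_Roumieu r N (fun a => s (mlen r a)).
Proof.
  intros [HN _] Hsup.
  assert (Hpos : forall p, 0 < small (N 1) p)
    by (intros p; apply small_pos, HN; lra).
  exists (small (N 1)); split; [intros p; now left | split].
  - apply divergent_of_root_unbounded; intros B HB.
    destruct (Hsup 1 Rlt_0_1 B) as (k & Hk & H).
    exists k; split; [easy |]; left; now apply pow_lt_of_root.
  - exists 1; split; [lra |]; exists 1; split; [lra |].
    exists 1; intros a _.
    rewrite pow1, !Rmult_1_l, Rabs_pos_eq; [lra | now left].
Qed.

(** * Strict inclusion and failure of surjectivity *)

Theorem mainTheorem10 (r : nat) (Hr : (1 <= r)%nat) (M N : R -> nat -> R)
  (HM : weight_matrix M) (HN : weight_matrix N)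
  (HMq : quasianalytic_matrix M) (HNq : quasianalytic_matrix N) :
  (* Roumieu case *)
  ((forall lam, 0 < lam -> forall B : R,
       exists k, (1 <= k)%nat /\ B < Rpower (small (N lam) k) (/ INR k)) ->
    (exists b, Lambda_Roumieu r N b /\ ~ jet_image_Roumieu r M b) /\
    (exists b, Lambda_Roumieu r N b /\ ~ jet_image_Beurling r M b) /\
    (exists b, Lambda_Roumieu r N b /\ ~ jet_image_Roumieu r N b))
  /\
  (* Beurling case *)
  ((forall lam, 0 < lam -> forall B : R, exists K, forall k, (K <= k)%nat -> (1 <= k)%nat ->
       B < Rpower (small (N lam) k) (/ INR k)) ->
    (exists b, Lambda_Beurling r N b /\ ~ jet_image_Roumieu r M b) /\
    (exists b, Lambda_Beurling r N b /\ ~ jet_image_Beurling r M b) /\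
    (exists b, Lambda_Beurling r N b /\ ~ jet_image_Beurling r N b)).
Proof.
  split; intros Hn.
  - destruct (Lambda_Roumieu_divergent r N HN Hn) as (s & Hs & Hd & HL).
    (* One jet serves all three claims: Beurling images lie in Roumieu images, and
       [divergent_not_jet] applies to [M] and to [N] alike. *)
    repeat split; exists (fun a => s (mlen r a)); split; try exact HL;
      try (intros HB; apply jet_image_Beurling_Roumieu in HB; revert HB);
      now apply divergent_not_jet.
  - destruct (Lambda_Beurling_divergent r N HN Hn) as (s & Hs & Hd & HL).
    repeat split; exists (fun a => s (mlen r a)); split; try exact HL;
      try (intros HB; apply jet_image_Beurling_Roumieu in HB; revert HB);
      now apply divergent_not_jet.
Qed.
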